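(* Let $X$ be a separable metrizable space. Then the Pixley-Roy hyperspace $PR(X)$ is selectively ccc if and only if every finite power of $X$ is Rothberger.
   Context: A space $Z$ is selectively ccc if for every sequence $(\mathcal{U}_n)_{n<\omega}$ of families of open subsets of $Z$ such that $\bigcup\mathcal{U}_n$ is dense in $Z$ for every $n$, one can pick $U_n\in\mathcal{U}_n$ for each $n<\omega$ such that $\bigcup_{n<\omega}U_n$ is dense in $Z$. A space $Z$ is Rothberger if for every sequence $(\mathcal{U}_n)_{n<\omega}$ of open covers of $Z$ one can pick $U_n\in\mathcal{U}_n$ for each $n<\omega$ such that $\{U_n:n<\omega\}$ covers $Z$. $PR(X)=[X]^{<\omega}$ is the set of all finite subsets of $X$ (including $\emptyset$) with the Pixley-Roy topology: a basic open neighbourhood of $F\in PR(X)$ is a set $[F,U]=\{G\in PR(X):F\subset G\subset U\}$, where $U\subset X$ is open in $X$ and $F\subset U$. *)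

(* Defs.v *)
From HB Require Import structures.
From mathcomp Require Import all_boot all_order all_algebra finmap.
From mathcomp Require Import all_classical all_reals all_analysis.

Set Implicit Arguments.
Unset Strict Implicit.
Unset Printing Implicit Defensive.

Import Order.TTheory GRing.Theory Num.Theory.

Local Open Scope classical_set_scope.
Local Open Scope ring_scope.

Definition separable (X : topologicalType) : Prop :=
  exists2 D : set X, countable D & dense D.

(* Nonnegativity of [d] follows from the three metric axioms. *)
Definition metrizable (R : realType) (X : topologicalType) : Prop :=
  exists d : X -> X -> R,
    [/\ forall x y, d x y = 0 <-> x = y,
        forall x y, d x y = d y x,
        forall x y z, d x z <= d x y + d y z &
        forall (x : X) (A : set X),
          nbhs x A <-> exists2 e : R, 0 < e & [set y | d x y < e] `<=` A].

Definition selectively_ccc (Z : topologicalType) : Prop :=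
  forall U : nat -> set (set Z),
    (forall n, U n `<=` open) ->
    (forall n, dense (\bigcup_(V in U n) V)) ->
    exists V : nat -> set Z,
      (forall n, U n (V n)) /\ dense (\bigcup_n V n).

(* A cover of a nonempty space is automatically a nonempty family, so the
   clause [U n !=set0] only matters when [Z] is empty: there the empty family
   is an open cover from which nothing can be picked, and the clause makes the
   empty space Rothberger, as every countable space is. *)
Definition rothberger (Z : topologicalType) : Prop :=
  forall U : nat -> set (set Z),
    (forall n, U n !=set0) ->
    (forall n, U n `<=` open) ->
    (forall n, \bigcup_(V in U n) V = [set: Z]) ->
    exists V : nat -> set Z,
      (forall n, U n (V n)) /\ \bigcup_n V n = [set: Z].

Definition pixley_roy (X : topologicalType) : Type := {fset X}.

HB.instance Definition _ (X : topologicalType) :=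
  Choice.copy (pixley_roy X) {fset X}.

(* [F, U] = {G : F \subset G \subset U} *)
Definition pr_nbhd (X : topologicalType) (F : {fset X}) (U : set X) :
    set (pixley_roy X) :=
  [set G : {fset X} | [set` F] `<=` [set` G] /\ [set` G] `<=` U].

Section PixleyRoyTopology.
Variable X : topologicalType.

Definition pr_open : set (set (pixley_roy X)) :=
  [set W | forall F : {fset X}, W F ->
    exists U : set X, [/\ open U, [set` F] `<=` U & pr_nbhd F U `<=` W]].

Let pr_openT : pr_open setT.
Proof. by move=> F _; exists setT; split=> //; exact: openT. Qed.

Let pr_openI : setI_closed pr_open.
Proof.
move=> A B oA oB F [/oA[U [oU FU UA]] /oB[V [oV FV VB]]].
exists (U `&` V); split; first exact: openI.
- by move=> x Fx; split; [exact: FU|exact: FV].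
- move=> G [FG GUV]; split; [apply: UA|apply: VB]; split=> // x /GUV.
  + by case.
  + by case.
Qed.

Let pr_open_bigU (I : Type) (f : I -> set (pixley_roy X)) :
  (forall i, pr_open (f i)) -> pr_open (\bigcup_i f i).
Proof.
move=> of_ F [i _ /of_[U [oU FU Uf]]].
by exists U; split=> // G /Uf; exists i.
Qed.

HB.instance Definition _ :=
  isOpenTopological.Build (pixley_roy X) pr_openT pr_openI pr_open_bigU.

End PixleyRoyTopology.

Lemma pixley_roy_openE (X : topologicalType) :
  @open (pixley_roy X) = @pr_open X.
Proof. by []. Qed.

Lemma open_pr_nbhd (X : topologicalType) (F : {fset X}) (U : set X) :
  open U -> open (pr_nbhd F U).
Proof.
move=> oU; rewrite pixley_roy_openE => G [FG GU]; exists U; split=> //.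
by move=> H [GH HU]; split=> //; exact: subset_trans GH.
Qed.

Lemma nbhs_pixley_royE (X : topologicalType) (F : pixley_roy X)
    (W : set (pixley_roy X)) :
  nbhs F W <->
  exists U : set X, [/\ open U, [set` (F : {fset X})] `<=` U & pr_nbhd F U `<=` W].
Proof.
rewrite nbhsE; split=> [[B [oB BF] BW]|[U [oU FU UW]]].
  move: oB; rewrite pixley_roy_openE => /(_ F BF)[U [oU FU UB]].
  by exists U; split=> //; exact: subset_trans BW.
by exists (pr_nbhd F U) => //; split; [exact: open_pr_nbhd|split].
Qed.

(* Main.v *)
(* If PR(X) is selectively ccc and (U_m) are open covers of X^k, the open sets M
   of PR(X) such that the H^k with H in M are all covered by one selection from
   the covers of row n form an open cover of PR(X), for every n.  A selection
   with dense union hits every [{y_1, ..., y_k}, X], so the corresponding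
   members cover every tuple y.

   Conversely let (U_m) be families with dense unions in PR(X).  To hit a basic
   set [F, W] with W fixed and F a k-tuple y, note that once G in [y, W] lies in
   a member containing [G, V], then z `|` G lies in that member and in [z, W]
   for all z in W^k near y.  So the Rothberger property of X^k deals with all
   such F at once, and countably many W suffice. *)
Require Import Defs.
From mathcomp Require Import all_boot all_order all_algebra finmap.
From mathcomp Require Import all_classical all_reals all_analysis.

Set Implicit Arguments.
Unset Strict Implicit.
Unset Printing Implicit Defensive.

Import Order.TTheory GRing.Theory Num.Theory.
Local Open Scope classical_set_scope.
Local Open Scope ring_scope.

(** The filter [G] of boxes around [p] converges to [p] in every coordinate, hence in the product
    topology, which is a supremum of initial topologies. *)
Lemma prod_nbhs_box (I : Type) (K : I -> topologicalType)
    (p : prod_topology K) (A : set (prod_topology K)) :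
  nbhs p A -> exists B : forall i, set (K i),
    (forall i, nbhs (p i) (B i)) /\ [set y | forall i, B i (y i)] `<=` A.
Proof.
pose D := [set B : forall i, set (K i) | forall i, nbhs (p i) (B i)].
pose G := filter_from D (fun B => [set y : prod_topology K | forall i, B i (y i)]).
have FG : Filter G.
  apply: filter_from_filter; first by exists (fun=> setT) => i; exact: filterT.
  move=> B C DB DC; exists (fun i => B i `&` C i).
    by move=> i; exact: filterI.
  by move=> y /= BCy; split=> i; have [] := BCy i.
suff Gp : G --> p by move=> /Gp [B DB BA]; exists B.
apply/cvg_sup => i C /=.
rewrite (@nbhsE (initial_topology (fun f : forall i, K i => f i))).
move=> -[_ [[Q oQ <-] /= Qp] QC].
have Qi : nbhs (p i) Q by exact: open_nbhs_nbhs.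
(* The box with side [Q] at [i] and full sides elsewhere; [Q] is transported along [j = i] because
   the factors [K j] are different types. *)
exists (fun j => [set x | forall e : j = i, Q (eq_rect j K x i e)]).
  move=> j; have [ji|ji] := pselect (j = i); last first.
    by apply: nearW => x /= e; case: (ji e).
  subst j; apply: filterS Qi => x Qx e.
  by rewrite (Prop_irrelevance e erefl).
by move=> y /= /(_ i erefl) Qy; exact: QC.
Qed.

Lemma prod_open_box (I : finType) (K : I -> topologicalType)
    (B : forall i, set (K i)) :
  (forall i, open (B i)) ->
  open [set y : prod_topology K | forall i, B i (y i)].
Proof.
move=> oB; rewrite openE => y By.
apply: (@filter_forall _ I (fun i => [set z : prod_topology K | B i (z i)])
  (nbhs y)) => i.
apply: (@proj_continuous I K i y (B i)); apply: open_nbhs_nbhs; split=> //.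
Qed.

Lemma prod_closed_box (I : eqType) (K : I -> topologicalType)
    (B : forall i, set (K i)) :
  (forall i, closed (B i)) ->
  closed [set y : prod_topology K | forall i, B i (y i)].
Proof.
move=> cB; rewrite (_ : mkset _ = \bigcap_i (@proj I K i @^-1` B i)); last first.
  by apply/seteqP; split=> y /= By i; [move=> _|]; exact: By.
apply: closed_bigI => i _; apply: preimage_closed (cB i) => y _.
exact: proj_continuous.
Qed.

(** Codes are injective, so the prescribed choices never clash; an index that codes nothing gets any
    member of [U n]. This lets one sequence be split into countably many rows. *)
Lemma selection_along_pickle (T : countType) (A : Type) (U : nat -> set A)
    (g : T -> A) :
  (forall n, U n !=set0) -> (forall t, U (choice.pickle t) (g t)) ->
  exists V : nat -> A,
    (forall n, U n (V n)) /\ forall t, V (choice.pickle t) = g t.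
Proof.
move=> U0 Ug; have /choice[V VP] : forall n, exists a, U n a /\
    forall t, n = choice.pickle t -> a = g t.
  move=> n; have [[t nE]|nt] := pselect (exists t : T, n = choice.pickle t).
    exists (g t); split; first by rewrite nE.
    by move=> t'; rewrite nE => /(pcan_inj choice.pickleK) ->.
  by have [a Ua] := U0 n; exists a; split=> // t nE; case: nt; exists t.
by exists V; split=> [n|t]; [exact: (VP n).1|exact: (VP _).2].
Qed.

(* The tube lemma for the finite, hence compact, set of tuples in [F]. *)
Lemma fset_power_tube (X : topologicalType) (k : nat) (F : {fset X})
    (G : {ffun 'I_k -> F} -> set {ptws 'I_k -> X}) :
  (forall p : {ffun 'I_k -> F},
    nbhs ((fun j => val (p j)) : {ptws 'I_k -> X}) (G p)) ->
  exists V : set X, [/\ open V, [set` F] `<=` V &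
    forall y : 'I_k -> X, (forall j, V (y j)) -> exists p, G p y].
Proof.
move=> nG; have /choice[B BP] := fun p => prod_nbhs_box (nG p).
(* A point of [F] occurs at finitely many positions of finitely many tuples, so the sides demanded
   there intersect in a neighbourhood of it. *)
pose W (x : F) := [set z | forall q : {ffun 'I_k -> F} * 'I_k,
  q.1 q.2 = x -> B q.1 q.2 z].
have nW (x : F) : nbhs (val x) (W x).
  apply: filter_forall => -[p j] /=; have [<-|pjx] := eqVneq (p j) x.
    by have [/(_ j) + _] := BP p; apply: filterS => z Bz _.
  by apply: nearW => z e; rewrite e eqxx in pjx.
exists (\bigcup_x (W x)°); split.
- by apply: bigcup_open => x _; exact: open_interior.
- by move=> x Fx; exists [` Fx]%fset => //; exact: (nW [` Fx]%fset).
- move=> y Vy; have /choice[p pP] : forall j, exists x : F, (W x)° (y j).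
    by move=> j; have [x _ Wx] := Vy j; exists x.
  exists (finfun p); have [_] := BP (finfun p); apply => j.
  by apply: (interior_subset (pP j) (finfun p, j)); rewrite /= ffunE.
Qed.

(* The [n]-th family of open sets handles the covers of indices [(n, i)] for
   all [i]: powers of finite sets need a number of members not bounded in
   advance. *)
Lemma selectively_ccc_rothberger_power (X : topologicalType) (k : nat) :
  selectively_ccc (pixley_roy X) -> rothberger {ptws 'I_k -> X}.
Proof.
move=> sccc U U0 oU covU.
pose W (n : nat) := [set M : set (pixley_roy X) | open M /\
  exists g : nat -> set {ptws 'I_k -> X},
    (forall i : nat, U (choice.pickle (n, i)) (g i)) /\
    forall (H : {fset X}) (y : 'I_k -> X), M H -> (forall j, y j \in H) ->
      exists i, g i y].
have [n M []//|n|M [WM dM]] := sccc W.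
  move=> O [F OF] oO; exists F; split=> //.
  have /choice[h hP] : forall p : {ffun 'I_k -> F},
      exists G, U (choice.pickle (n, choice.pickle p)) G /\
        G ((fun j => val (p j)) : {ptws 'I_k -> X}).
    move=> p; have : [set: {ptws 'I_k -> X}] (fun j => val (p j)) by [].
    by rewrite -(covU (choice.pickle (n, choice.pickle p))) => -[G UG Gp];
       exists G.
  have [g [Ug gh]] := selection_along_pickle
    (fun i => U0 (choice.pickle (n, i))) (fun p => (hP p).1).
  have [p|V [oV FV tube]] := @fset_power_tube X k F h.
    by apply: open_nbhs_nbhs; split; [exact: oU (hP p).1|exact: (hP p).2].
  exists (pr_nbhd F V); last by split.
  split; first exact: open_pr_nbhd.
  exists g; split=> // H y [_ HV] yH.
  have [j|p hy] := tube y; first exact: HV (yH j).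
  by exists (choice.pickle p); rewrite gh.
have /choice[g gP] := fun n => (WM n).2.
have [V [UV VE]] := @selection_along_pickle (nat * nat)%type _ U
  (fun q => g q.1 q.2) U0 (fun q => (gP q.1).1 q.2).
exists V; split=> //.
apply/seteqP; split=> // y _.
have [||H [[FH _] [n _ MH]]] :=
  dM (pr_nbhd [fset y j | j in 'I_k]%fset [set: X]).
- by exists [fset y j | j in 'I_k]%fset; split.
- exact/open_pr_nbhd/openT.
have [|i gy] := (gP n).2 H y MH.
  by move=> j; apply: FH; rewrite /= in_imfset.
by exists (choice.pickle (n, i)) => //; rewrite VE.
Qed.

(* Shrinking the open sets [W t] to closed sets [C t] makes it enough to cover
   the powers of [C t], which inherit the Rothberger property from those of
   [X] without any appeal to F-sigma sets. *)
Lemma rothberger_powers_selectively_ccc (T : countType) (X : topologicalType)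
    (C W : T -> set X) :
  (forall t, closed (C t)) -> (forall t, open (W t)) ->
  (forall t, C t `<=` W t) ->
  (forall (F : {fset X}) (U : set X), open U -> [set` F] `<=` U ->
    exists t, [set` F] `<=` C t /\ W t `<=` U) ->
  (forall n, rothberger {ptws 'I_n -> X}) -> selectively_ccc (pixley_roy X).
Proof.
move=> cC oW CW CWbase rX U oU dU.
have U0 n : U n !=set0.
  have [||_ [_ [M UM _]]] := dU n setT; first by exists fset0.
    exact: openT.
  by exists M.
pose fs k (y : 'I_k -> X) : {fset X} := [fset y j | j in 'I_k]%fset.
have fsP k (y : 'I_k -> X) (A : set X) :
    [set` fs k y] `<=` A <-> forall j, A (y j).
  split=> [sA j|Ay _ /= /imfsetP[j _ ->]//].
  by apply: sA; rewrite /= in_imfset.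
have fs_surj (F : {fset X}) : exists k (y : 'I_k -> X), fs k y = F.
  exists (size F), (tnth (in_tuple F)); apply/fsetP => x.
  apply/imfsetP/idP => [[j _ ->]|Fx]; first exact: mem_tnth.
  by have /tnthP[j ->] : x \in in_tuple F by []; exists j.
have /choice[N NP] : forall q : T * nat, exists N : nat -> set (pixley_roy X),
    (forall j, U (choice.pickle (q, j)) (N j)) /\
    forall y : 'I_q.2 -> X, (forall i, C q.1 (y i)) ->
      exists j, pr_nbhd (fs _ y) (W q.1) `&` N j !=set0.
  move=> [t k] /=.
  pose O (j : nat) := [set A : set {ptws 'I_k -> X} | open A /\
    exists M, U (choice.pickle (t, k, j)) M /\
    forall y, A y -> (forall i, C t (y i)) ->
      pr_nbhd (fs k y) (W t) `&` M !=set0].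
  have [j|j A []//|j|A [OA covA]] := rX k O.
  (* The empty set qualifies vacuously, so [O j] is nonempty even when the power is empty. *)
  - have [M UM] := U0 (choice.pickle (t, k, j)).
    by exists set0; split; [exact: open0|exists M; split].
  - apply/seteqP; split=> // y _.
    have [Cy|Cy] := pselect (forall i, C t (y i)); last first.
      (* Tuples that leave [C t] are covered by an open set on which the condition in [O] is
         vacuous; this is where [C t] must be closed. *)
      exists (~` [set z : {ptws 'I_k -> X} | forall i, C t (z i)]) => //.
      split; first exact/closed_openC/(@prod_closed_box _ (fun=> X) (fun=> C t)).
      by have [M UM] := U0 (choice.pickle (t, k, j)); exists M; split.
    have [||G [[yG GW] [M UM MG]]] :=
        dU (choice.pickle (t, k, j)) (pr_nbhd (fs k y) (W t)).
    + by exists (fs k y); split=> //; apply/fsP => i; exact: CW.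
    + exact: open_pr_nbhd.
    have := oU _ _ UM; rewrite pixley_roy_openE => /(_ G MG)[V [oV GV VM]].
    (* This box contains [y] because [fs k y] lies inside [G], which lies inside [V]. *)
    exists [set z | forall i, V (z i)]; last first.
      by move=> /= i; move/fsP : (subset_trans yG GV); apply.
    split; first exact: (@prod_open_box _ (fun=> X) (fun=> V)).
    exists M; split=> // z Vz Cz; exists (fs k z `|` G)%fset.
    have sub A : [set` fs k z] `<=` A -> [set` G] `<=` A ->
        [set` (fs k z `|` G)%fset] `<=` A.
      by move=> zA GA x /=; rewrite in_fsetU => /orP[/zA|/GA].
    split; last apply: VM.
    + split; first by move=> x /= xz; rewrite in_fsetU xz.
      by apply: sub => //; apply/fsP => i; exact: CW.
    + split; first by move=> x /= xG; rewrite in_fsetU xG orbT.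
      by apply: sub => //; apply/fsP.
  have /choice[N NP] := fun j => (OA j).2.
  exists N; split=> [j|y Cy]; first exact: (NP j).1.
  have : [set: {ptws 'I_k -> X}] y by [].
  by rewrite -covA => -[j _ Ay]; exists j; exact: (NP j).2.
have [V [UV VE]] := @selection_along_pickle (T * nat * nat)%type _ U
  (fun p => N p.1 p.2) U0 (fun p => (NP p.1).1 p.2).
exists V; split=> // O [F OF] oO.
move: oO; rewrite pixley_roy_openE => /(_ F OF)[A [oA FA AO]].
have [t [FC WA]] := CWbase _ _ oA FA.
have [k [y yF]] := fs_surj F; rewrite -{}yF in FA FC AO.
have [|j [H [[yH HW] NH]]] := (NP (t, k)).2 y; first exact/fsP.
exists H; split; first by apply: AO; split=> //; exact: subset_trans WA.
by exists (choice.pickle ((t, k), j)) => //; rewrite VE.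
Qed.

(** [W t] is a finite union of balls centred in the dense set, coded by [t.1], and [C t] consists of
    the points whose ball of radius [1/(t.2+1)] lies in [W t]. A finite subset of [W t] lies in
    [C t] once [t.2] is large. *)
Lemma separable_metrizable_closed_open_base (R : realType)
    (X : topologicalType) :
  separable X -> metrizable R X ->
  exists C W : seq (nat * nat) * nat -> set X,
    [/\ forall t, closed (C t), forall t, open (W t),
        forall t, C t `<=` W t &
        forall (F : {fset X}) (U : set X), open U -> [set` F] `<=` U ->
          exists t, [set` F] `<=` C t /\ W t `<=` U].
Proof.
move=> [D /countable_injP[f finj] dD] [d [d0 dC dT dnbhs]].
have open_ball x (e : R) : open [set y | d x y < e].
  rewrite openE => y /= xy; apply/dnbhs; exists (e - d x y).
    by rewrite subr_gt0.
  move=> z /= yz; apply: le_lt_trans (dT x y z) _.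
  by rewrite addrC -ltrBrDr.
have inv_gt0 n : 0 < n.+1%:R^-1 :> R by rewrite invr_gt0.
have small (e : R) : 0 < e -> exists n : nat, n.+1%:R^-1 < e.
  by move=> /ltr_add_invr[n]; rewrite add0r; exists n.
have le_inv m n : (m <= n)%N -> n.+1%:R^-1 <= m.+1%:R^-1 :> R.
  by move=> mn; rewrite lef_pV2 ?posrE// ler_nat.
pose B (a : nat * nat) := [set y | exists x, [/\ D x, f x = a.1 &
  d x y < a.2.+1%:R^-1]].
pose W (t : seq (nat * nat) * nat) := [set y | exists2 a, a \in t.1 & B a y].
pose C t := [set x | forall y, d x y < t.2.+1%:R^-1 -> W t y].
have oW t : open (W t).
  rewrite openE => y [a ta [x [Dx fx xy]]].
  apply: (@filterS _ (nbhs y) _ [set z | d x z < a.2.+1%:R^-1]).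
    by move=> z xz; exists a => //; exists x.
  exact: open_nbhs_nbhs.
exists C, W; split=> //.
(* If [y] witnesses that [x] is outside [C t], it does so for every point within the same radius of
   [y]. *)
- move=> t; rewrite -openC openE => x /existsNP[y /not_implyP[xy Wy]].
  apply: (@filterS _ (nbhs x) _ [set z | d y z < t.2.+1%:R^-1]).
    by move=> z /= yz; move=> /(_ y); rewrite dC => /(_ yz).
  by apply: open_nbhs_nbhs; split => //=; rewrite dC.
- by move=> t x; apply; rewrite (d0 x x).2.
move=> F U oU FU.
have /choice[a aP] : forall x : X, exists a, U x -> B a x /\ B a `<=` U.
  move=> x; have [Ux|Ux] := pselect (U x); last by exists (0, 0)%N.
  have /dnbhs[e e0 eU] : nbhs x U by exact: open_nbhs_nbhs.
  (* With radius below [e / 2], a ball centred at a point of [D] that close to [x] contains [x] and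
     stays within [e] of [x]. *)
  have [n ne] : exists n : nat, n.+1%:R^-1 < e / 2 by apply: small; rewrite divr_gt0.
  have [|z [/= xz Dz]] := dD [set y | d x y < n.+1%:R^-1] _ (open_ball _ _).
    by exists x; rewrite /= (d0 x x).2.
  exists (f z, n) => _; split; first by exists z; split=> //=; rewrite dC.
  move=> y [w [/= Dw fw wy]].
  have wz : w = z by apply: finj => //; exact/mem_set.
  apply: eU => /=; apply: le_lt_trans (dT x z y) _.
  rewrite (splitr e); apply: ltrD; first exact: lt_trans ne.
  by rewrite -wz; exact: lt_trans ne.
pose c := [seq a x | x <- enum_fset F].
have WU n : W (c, n) `<=` U.
  by move=> y [_ /mapP[x xF ->] By]; have [_] := aP x (FU x xF); apply.
have FW n x : x \in F -> W (c, n) x.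
  move=> xF; exists (a x); first exact: map_f.
  by have [] := aP x (FU x xF).
(* [W (c, n)] is the same set for every [n], so a radius is found for each point with [n = 0], and
   the smallest of these radii over [F] is taken afterwards. *)
have /choice[m mP] : forall x, exists m : nat, x \in F ->
    forall y, d x y < m.+1%:R^-1 -> W (c, 0%N) y.
  move=> x; have [xF|xF] := boolP (x \in F); last by exists 0%N.
  have /dnbhs[e e0 eW] : nbhs x (W (c, 0%N)).
    by apply: open_nbhs_nbhs; split; [exact: oW|exact: FW].
  have [n ne] := small _ e0.
  by exists n => _ y xy; apply: eW; exact: lt_trans ne.
exists (c, (\max_(x <- enum_fset F) m x)%N); split; last exact: WU.
move=> x xF y /= xy; apply: (mP x xF); apply: lt_le_trans xy _.
by apply: le_inv; apply: leq_bigmax_seq.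
Qed.

Theorem corollary2p10 (R : realType) (X : topologicalType)
    (sepX : separable X) (metX : metrizable R X) :
  selectively_ccc (pixley_roy X) <->
  forall n : nat, rothberger {ptws 'I_n -> X}.
Proof.
split=> [sccc n|]; first exact: selectively_ccc_rothberger_power.
have [C [W [cC oW CW base]]] := separable_metrizable_closed_open_base sepX metX.
exact: rothberger_powers_selectively_ccc cC oW CW base.
Qed.
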